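(* The category $\mathcal{D}_{\mathcal{B}}$ of friezes of finite type with even natural numbers as objects is isomorphic to the simplicial category $\Delta$. More precisely, the functor $S:\mathcal{D}_{\mathcal{B}}\to\Delta$, which on objects is given by $S(2n)=n$ and which maps a frieze $D$ indexed by $(2n,2m)$ to the order-preserving function $\{0,\ldots,n-1\}\to\{0,\ldots,m-1\}$ obtained by restricting the domain of $\varphi(D):\mathbb{N}\to\mathbb{N}$ to $n=\{0,\ldots,n-1\}$ and the codomain to $m=\{0,\ldots,m-1\}$, is an isomorphism of categories.
   Context: The simplicial category $\Delta$ has as objects all finite ordinals $n=\{0,\ldots,n-1\}$ (including $0$) and as arrows all order-preserving functions. $\mathbb{N}$ includes $0$; $\mathbb{N}^+=\mathbb{N}\setminus\{0\}$. A segment $[a,b]$ with $a<b$ in $\mathbb{Z}\setminus\{0\}$ is $\{z\in\mathbb{Z}\setminus\{0\}\mid a\le z\le b\}$, with end points $a,b$. $[a,b]$ encloses $[c,d]$ when $a<c$ and $d<b$. A set of segments is nonoverlapping when every two distinct segments in it are either disjoint or one encloses the other. It exhausts $\mathbb{Z}\setminus\{0\}$ when every element of $\mathbb{Z}\setminus\{0\}$ is an end point of some segment in it. A segment $[a,b]$ is transversal when $a<0<b$, a cup when $0<a<b$, a cap when $a<b<0$. A frieze is a set of nonoverlapping segments exhausting $\mathbb{Z}\setminus\{0\}$ whose cups are all of the form $[2k+2,2k+3]$ and whose caps are all of the form $[-(2k+2),-(2k+1)]$, with $k\in\mathbb{N}$. The unit frieze is $\{[-k,k]\mid k\in\mathbb{N}^+\}$.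 Composition $D_2\circ D_1$ is obtained by putting the diagram of $D_2$ below the diagram of $D_1$: take three disjoint copies of the positive integers (top, middle, bottom points); regard each segment of $D_1$ as an edge, a positive end point $k$ being the top point $k$ and a negative end point $-k$ being the middle point $k$; regard each segment of $D_2$ as an edge, a positive end point $k$ being the middle point $k$ and a negative end point $-k$ being the bottom point $k$. The segments of $D_2\circ D_1$ join those pairs of distinct points among top points $k$ (read as $k$) and bottom points $k$ (read as $-k$) that are connected by a path in this graph. Friezes form a monoid with this composition and the unit frieze. A frieze is of type $(n,m)$ when for every $k\in\mathbb{N}^+$ it contains the transversal segment $[-(m+k),n+k]$. The category $\mathcal{D}_{\mathcal{B}}$ has as objects all even natural numbers (including $0$), and as arrows from $n$ to $m$ all friezes of type $(n,m)$ indexed by $(n,m)$, with composition of friezes and the unit frieze as identities. In a frieze the end points of a transversal segment are either both odd (odd transversal segment) or both even. The successor of a transversal segment is the transversal segment with the next larger positive end point. A transversal pair consists of an odd transversal segment $[-(2k_1+1),2k_2+1]$ and its successor, which is of the form $[-(2k_1+2),2k_2+2k_3+2]$; it covers $n\in\mathbb{N}$ when $k_2\le n\le k_2+k_3$, and it assigns $k_1$ to each such $n$. In every frieze $D$ every $n\in\mathbb{N}$ is covered by exactly one transversal pair, and $\varphi(D):\mathbb{N}\to\mathbb{N}$ maps $n$ to the number assigned to $n$ by that pair. *)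

(* Defs.v *)
From mathcomp Require Import all_boot all_order all_algebra.
From mathcomp Require Import boolp classical_sets.
From Stdlib Require Import Relations.Relation_Operators.

Set Implicit Arguments.
Unset Strict Implicit.
Unset Printing Implicit Defensive.

Import Order.TTheory GRing.Theory Num.Theory.
Local Open Scope classical_set_scope.
Local Open Scope ring_scope.

(* A category with prescribed objects and hom-types; arrows are compared by
   Leibniz equality.  [compose g f] is "g after f". *)
Record category (ob : Type) (hom : ob -> ob -> Type) := Category {
  identity : forall x, hom x x;
  compose : forall x y z, hom y z -> hom x y -> hom x z;
  compose_idl : forall x y (f : hom x y), compose (identity y) f = f;
  compose_idr : forall x y (f : hom x y), compose f (identity x) = f;
  compose_assoc : forall x y z w (h : hom z w) (g : hom y z) (f : hom x y),
    compose h (compose g f) = compose (compose h g) f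
}.

Record functor (ob1 : Type) (hom1 : ob1 -> ob1 -> Type) (C : category hom1)
    (ob2 : Type) (hom2 : ob2 -> ob2 -> Type) (D : category hom2) := Functor {
  on_ob :> ob1 -> ob2;
  on_hom : forall x y, hom1 x y -> hom2 (on_ob x) (on_ob y);
  on_hom_id : forall x, on_hom (identity C x) = identity D (on_ob x);
  on_hom_comp : forall x y z (g : hom1 y z) (f : hom1 x y),
    on_hom (compose C g f) = compose D (on_hom g) (on_hom f)
}.

Definition functor_id (ob : Type) (hom : ob -> ob -> Type) (C : category hom) :
    functor C C :=
  @Functor _ _ C _ _ C id (fun _ _ f => f) (fun _ => erefl)
    (fun _ _ _ _ _ => erefl).

Section FunctorComposition.
Variables (ob1 : Type) (hom1 : ob1 -> ob1 -> Type) (C : category hom1).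
Variables (ob2 : Type) (hom2 : ob2 -> ob2 -> Type) (D : category hom2).
Variables (ob3 : Type) (hom3 : ob3 -> ob3 -> Type) (E : category hom3).
Variables (G : functor D E) (F : functor C D).

Lemma functor_comp_id x :
  on_hom G (on_hom F (identity C x)) = identity E (G (F x)).
Proof. by rewrite !on_hom_id. Qed.

Lemma functor_comp_comp x y z (g : hom1 y z) (f : hom1 x y) :
  on_hom G (on_hom F (compose C g f)) =
  compose E (on_hom G (on_hom F g)) (on_hom G (on_hom F f)).
Proof. by rewrite !on_hom_comp. Qed.

Definition functor_comp : functor C E :=
  Functor functor_comp_id functor_comp_comp.
End FunctorComposition.

Definition is_isomorphism (ob1 : Type) (hom1 : ob1 -> ob1 -> Type)
    (C : category hom1) (ob2 : Type) (hom2 : ob2 -> ob2 -> Type)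
    (D : category hom2) (F : functor C D) : Prop :=
  exists G : functor D C,
    functor_comp G F = functor_id C /\ functor_comp F G = functor_id D.

Record delta_hom (n m : nat) := DeltaHom {
  delta_fun :> 'I_n -> 'I_m;
  delta_mono : {homo delta_fun : i j / (i <= j)%N}
}.

Lemma delta_hom_eq n m (f g : delta_hom n m) : f =1 g -> f = g.
Proof.
case: f g => [f fP] [g gP] /= /funext fg; rewrite {}fg in fP *.
by congr DeltaHom; apply: Prop_irrelevance.
Qed.

Definition delta_id n : delta_hom n n := @DeltaHom n n id (fun _ _ h => h).

Definition delta_comp n m p (g : delta_hom m p) (f : delta_hom n m) :
    delta_hom n p :=
  @DeltaHom n p (g \o f) (fun i j h => delta_mono g (delta_mono f h)).

Definition Delta : category delta_hom.
Proof.
by refine (@Category nat delta_hom delta_id delta_comp _ _ _) => *;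
  apply: delta_hom_eq.
Defined.

(* The segment [a, b] of Z \ {0} is encoded by its pair of end points. *)
Definition is_segment (s : int * int) : bool :=
  [&& s.1 != 0, s.2 != 0 & s.1 < s.2].

Definition seg_points (s : int * int) : set int :=
  [set z | z != 0 /\ s.1 <= z <= s.2].

Definition encloses (s t : int * int) : bool := (s.1 < t.1) && (t.2 < s.2).

Definition transversal (s : int * int) : bool := s.1 < 0 < s.2.
Definition cup (s : int * int) : bool := 0 < s.1 < s.2.
Definition cap (s : int * int) : bool := s.1 < s.2 < 0.

Definition nonoverlapping (D : set (int * int)) : Prop :=
  forall s t, D s -> D t -> s <> t ->
    [\/ seg_points s `&` seg_points t = set0, encloses s t | encloses t s].

Definition exhausts (D : set (int * int)) : Prop :=
  forall z : int, z != 0 -> exists2 s, D s & z = s.1 \/ z = s.2.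

Record is_frieze (D : set (int * int)) : Prop := IsFrieze {
  frieze_segment : forall s, D s -> is_segment s;
  frieze_nonoverlapping : nonoverlapping D;
  frieze_exhausts : exhausts D;
  frieze_cup : forall s, D s -> cup s ->
    exists k : nat, s = (Posz (2 * k + 2)%N, Posz (2 * k + 3)%N);
  frieze_cap : forall s, D s -> cap s ->
    exists k : nat, s = (- Posz (2 * k + 2)%N, - Posz (2 * k + 1)%N)
}.

Definition unit_frieze : set (int * int) :=
  [set s | exists2 k : nat, (0 < k)%N & s = (- Posz k, Posz k)].

(* Only indices k > 0 are meaningful; the index 0 gives isolated points that
   are never the image of a nonzero integer. *)
Inductive point := Top of nat | Middle of nat | Bottom of nat.

Definition upper_point (z : int) : point :=
  if 0 < z then Top `|z|%N else Middle `|z|%N.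
Definition lower_point (z : int) : point :=
  if 0 < z then Middle `|z|%N else Bottom `|z|%N.
Definition outer_point (z : int) : point :=
  if 0 < z then Top `|z|%N else Bottom `|z|%N.

Definition edge (D2 D1 : set (int * int)) (p q : point) : Prop :=
  (exists2 s, D1 s & p = upper_point s.1 /\ q = upper_point s.2) \/
  (exists2 s, D2 s & p = lower_point s.1 /\ q = lower_point s.2).

(* Edges are undirected, hence the symmetric closure. *)
Definition connected (D2 D1 : set (int * int)) : point -> point -> Prop :=
  clos_refl_sym_trans point (edge D2 D1).

(* Argument order as in D2 o D1: D1 is the upper diagram. *)
Definition frieze_comp (D2 D1 : set (int * int)) : set (int * int) :=
  [set s | is_segment s /\
           connected D2 D1 (outer_point s.1) (outer_point s.2)].

Definition has_type (n m : nat) (D : set (int * int)) : Prop :=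
  forall k : nat, (0 < k)%N -> D (- Posz (m + k)%N, Posz (n + k)%N).

Record even_nat := EvenNat { even_val :> nat; even_valP : ~~ odd even_val }.

Lemma double_even n : ~~ odd (2 * n).
Proof. by rewrite mul2n odd_double. Qed.

Definition twice (n : nat) : even_nat := EvenNat (double_even n).

Record frieze_hom (n m : even_nat) := FriezeHom {
  frieze_of :> set (int * int);
  frieze_ofP : is_frieze frieze_of;
  frieze_of_type : has_type n m frieze_of
}.

Definition successor (D : set (int * int)) (s t : int * int) : Prop :=
  [/\ D t, transversal t, s.2 < t.2 &
      forall u, D u -> transversal u -> s.2 < u.2 -> t.2 <= u.2].

Definition transversal_pair (D : set (int * int)) (k1 k2 k3 : nat) : Prop :=
  let s := (- Posz (2 * k1 + 1)%N, Posz (2 * k2 + 1)%N) in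
  let t := (- Posz (2 * k1 + 2)%N, Posz (2 * k2 + 2 * k3 + 2)%N) in
  D s /\ successor D s t.

Definition assigned (D : set (int * int)) (n k1 : nat) : Prop :=
  exists k2 k3 : nat, transversal_pair D k1 k2 k3 /\ (k2 <= n <= k2 + k3)%N.

(* The number assigned to n by the transversal pair of D covering n.  When D
   is a frieze there is exactly one such pair, so the default 0 of [xget] is
   never used. *)
Definition phi (D : set (int * int)) (n : nat) : nat :=
  xget 0%N [set k | assigned D n k].

(* Main.v *)
Require Import Defs.
From mathcomp Require Import all_boot all_order all_algebra.
From mathcomp Require Import boolp classical_sets.
From mathcomp Require Import zify.
From Stdlib Require Import Relations.Relation_Operators.

Set Implicit Arguments.
Unset Strict Implicit.
Unset Printing Implicit Defensive.

Import Num.Theory.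
Local Open Scope classical_set_scope.
Local Open Scope ring_scope.

(** Think of the top points 2i+1 and 2i+2 as the left and right sides of a
thick dot i, of the bottom points 2l+1 and 2l+2 as the two sides of a thick
dot l, and of an unbounded order-preserving map f : nat -> nat as thick lines
joining the top dot i to the bottom dot f i. The boundary curves of the
resulting planar figure form a frieze: between two consecutive top dots with
the same value there is a cup, a bottom dot outside the image of f is
surrounded by a cap, and the leftmost and rightmost top dots over a value give
an odd and an even transversal segment.

This picture becomes algebra through the lower adjoint e of f, determined by
e l <= i <-> l <= f i. Attach to the two sides of the top dot i the labels
(f i, i) and (f i, i+1), and to the two sides of the bottom dot l the labels
(l, e l) and (l, e (l+1)). Each label that occurs is carried by exactly two
points (label_colour_inj, partner_exists), and the segments of the frieze of f
are the pairs of points with equal labels. The map phi of the frieze is f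
itself (phi_strands).

Composition is handled by the same labels. In the diagram of g over f glued
along the middle points, extend the labels of g o f to the middle points, the
sides of the dot k getting (g k, e k) and (g k, e (k+1)). Edges preserve
labels. Conversely the labels are nondecreasing along the middle line, so that
two middle points with the same label are linked by a chain of consecutive
middle points with that label, and consecutive ones are joined by a cap of f or a cup
of g. Hence being connected means having the same label, which is strands_comp.

It remains that every frieze D of type (2n, 2m) arises in this way
(frieze_strands). Let a i count the indices k < i whose cup [2k+2, 2k+3] is
not in D, and b l those k < l whose cap [-(2k+2), -(2k+1)] is not in D. Since
transversal segments match their top and bottom ends in order, both ends of a
transversal segment have the same number of crossed points before them. At the
top point 2i+1 or 2i+2 this number is 2 (a i) or 2 (a i) + 1, at the bottom
point 2l+1 or 2l+2 it is 2 (b l) or 2 (b l) + 1, so the parities agree and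
a i = b l. Putting l <= f i <-> b l <= a i <-> e l <= i defines f and e, and
D is then the frieze of f.

Consequently phi is a bijection from friezes of type (2n, 2m) to
order-preserving maps f with f (n + j) = m + j and f i < m for i < n, that is,
to arrows of the simplicial category, and it takes composition to composition. *)

(** * Adjoint pairs of order-preserving maps *)

Definition galois (e f : nat -> nat) : Prop :=
  forall l i, (e l <= i)%N = (l <= f i)%N.

Section GaloisTheory.
Variables e f : nat -> nat.
Hypothesis ef : galois e f.

Lemma galois_homo_upper i j : (i <= j)%N -> (f i <= f j)%N.
Proof. by move=> ij; rewrite -ef (leq_trans _ ij) // ef. Qed.

Lemma galois_homo_lower k l : (k <= l)%N -> (e k <= e l)%N.
Proof. by move=> kl; rewrite ef (leq_trans kl) // -ef. Qed.

Lemma galois_lower_unique e' : galois e' f -> e = e'.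
Proof.
move=> e'f; apply/funext => l; apply/eqP.
by rewrite eqn_leq ef e'f -e'f -ef !leqnn.
Qed.
End GaloisTheory.

Lemma galois_comp e f e' f' : galois e f -> galois e' f' ->
  galois (e \o e') (f' \o f).
Proof. by move=> ef ef' l i /=; rewrite ef ef'. Qed.

Lemma galois_exists f : {homo f : i j / (i <= j)%N} ->
  (forall l, exists i, l <= f i)%N -> exists e, galois e f.
Proof.
move=> fm fu; exists (fun l => ex_minn (fu l)) => l i.
case: ex_minnP => j lj jmin; apply/idP/idP => [/fm|]; last exact: jmin.
exact: leq_trans lj.
Qed.

(** * The frieze of an adjoint pair *)

Section Strands.
Variables e f : nat -> nat.

(** `|z|.-1 is the position of the end point counted from 0, so that
halving gives the dot and uphalf adds one on right sides. *)
Definition label (z : int) : nat * nat :=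
  if 0 < z then (f `|z|.-1./2, uphalf `|z|.-1)%N
  else (`|z|.-1./2, e (uphalf `|z|.-1))%N.

(** Every boundary curve can be oriented with the thick lines on its left; the
colour tells whether the curve enters or leaves the strip at z. *)
Definition colour (z : int) : bool := (0 < z) (+) odd `|z|%N.

Definition strands : set (int * int) :=
  [set s | is_segment s /\ label s.1 = label s.2].

Lemma label_top_odd i : label (Posz (2 * i + 1)) = (f i, i).
Proof.
rewrite /label ifT; last lia.
by congr (f _, _); lia.
Qed.

Lemma label_top_even i : label (Posz (2 * i + 2)) = (f i, i.+1).
Proof.
rewrite /label ifT; last lia.
by congr (f _, _); lia.
Qed.

Lemma label_bottom_odd l : label (- Posz (2 * l + 1)) = (l, e l).
Proof.
rewrite /label ifF; last lia.
by congr (_, e _); lia.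
Qed.

Lemma label_bottom_even l : label (- Posz (2 * l + 2)) = (l, e l.+1).
Proof.
rewrite /label ifF; last lia.
by congr (_, e _); lia.
Qed.

Definition labelE :=
  (label_top_odd, label_top_even, label_bottom_odd, label_bottom_even).
End Strands.

(** Sides of the top and bottom dots, in the order left, right. *)
Variant position : int -> Type :=
| TopOdd i : position (Posz (2 * i + 1))
| TopEven i : position (Posz (2 * i + 2))
| BottomOdd l : position (- Posz (2 * l + 1))
| BottomEven l : position (- Posz (2 * l + 2)).

Lemma positionP z : z != 0 -> position z.
Proof.
move=> z0; case: (ltrP 0 z) => zs; case: (boolP (odd `|z|%N)) => zo.
- have -> : z = Posz (2 * `|z|%N.-1./2 + 1) by lia.
  by constructor.
- have -> : z = Posz (2 * `|z|%N.-1./2 + 2) by lia.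
  by constructor.
- have -> : z = - Posz (2 * `|z|%N.-1./2 + 1) by lia.
  by constructor.
- have -> : z = - Posz (2 * `|z|%N.-1./2 + 2) by lia.
  by constructor.
Qed.

Section StrandsFrieze.
Variables e f : nat -> nat.
Hypothesis ef : galois e f.
Local Notation label := (label e f).

(** On each of the four kinds of points the label is visibly injective; the two
remaining coincidences, left side of i with right side of l and conversely,
contradict the adjunction. *)
Lemma label_colour_inj z w : z != 0 -> w != 0 ->
  label z = label w -> colour z = colour w -> z = w.
Proof.
move=> z0 w0; case: (positionP z0) => i; case: (positionP w0) => j;
  rewrite !labelE /colour; case=> h1 h2; try lia.
- by move: (ef j.+1 i); lia.
- by move: (ef j i); lia.
- by move: (ef i j); lia.
- by move: (ef i.+1 j); lia.
Qed.

(** The mate of z is the neighbouring side across the adjacent gap when f (or e,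
for bottom points) takes the same value on both sides of the gap, and lies on
the opposite line otherwise. *)
Lemma partner_exists z : z != 0 ->
  exists w, [/\ w != 0, label w = label z & w != z].
Proof.
case/positionP => [i|i|l|l].
- case: (eqVneq (e (f i)) i) => fi.
    by exists (- Posz (2 * f i + 1)); rewrite !labelE fi; split => //; lia.
  have ei : (e (f i) <= i.-1)%N by move: (ef (f i) i); lia.
  exists (Posz (2 * i.-1 + 2)); rewrite !labelE; split; try lia.
  congr (_, _); last lia.
  by move: ei (galois_homo_upper ef (leq_pred i)); rewrite ef; lia.
- case: (eqVneq (f i) (f i.+1)) => fi.
    exists (Posz (2 * i.+1 + 1)); rewrite !labelE fi; split => //; lia.
  exists (- Posz (2 * f i + 2)); rewrite !labelE; split => //; try lia.
  congr (_, _); have := galois_homo_upper ef (leqnSn i).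
  by move: (ef (f i).+1 i) (ef (f i).+1 i.+1); lia.
- case: (eqVneq (e l) (e l.+1)) => el.
    by exists (- Posz (2 * l + 2)); rewrite !labelE el; split => //; lia.
  exists (Posz (2 * e l + 1)); rewrite !labelE; split => //; try lia.
  congr (_, _); have := galois_homo_lower ef (leqnSn l).
  by move: (ef l (e l)) (ef l.+1 (e l)); lia.
- case: (eqVneq (e l) (e l.+1)) => el.
    by exists (- Posz (2 * l + 1)); rewrite !labelE el; split => //; lia.
  have := galois_homo_lower ef (leqnSn l) => ell.
  exists (Posz (2 * (e l.+1).-1 + 2)); rewrite !labelE; split => //; try lia.
  congr (_, _); last lia.
  by move: (ef l (e l.+1).-1) (ef l.+1 (e l.+1).-1); lia.
Qed.

Lemma strand_through z w : z != 0 -> w != 0 -> label z = label w -> z != w ->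
  strands e f (z, w) \/ strands e f (w, z).
Proof.
move=> z0 w0 zw nzw; have [lt|le] := ltrP z w; [left|right];
  by split; rewrite // /is_segment /= z0 w0; lia.
Qed.

(** Two of any three points have the same colour. *)
Lemma label_third z w v : z != 0 -> w != 0 -> v != 0 ->
  label z = label w -> label z = label v -> z != w -> z != v -> w = v.
Proof.
move=> z0 w0 v0 zw zv nzw nzv; apply: label_colour_inj => //.
  by rewrite -zw.
have /eqP cw : colour z != colour w.
  by apply: contraNneq nzw => c; apply/eqP/label_colour_inj.
have /eqP cv : colour z != colour v.
  by apply: contraNneq nzv => c; apply/eqP/label_colour_inj.
by move: cw cv; do 3!case: colour.
Qed.

(** The explicit list of segments read off from the picture. *)
Variant strand : int * int -> Prop :=
| CupStrand k : f k = f k.+1 -> strand (Posz (2 * k + 2), Posz (2 * k + 3))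
| CapStrand k : e k = e k.+1 -> strand (- Posz (2 * k + 2), - Posz (2 * k + 1))
| OddStrand l i : f i = l -> e l = i ->
    strand (- Posz (2 * l + 1), Posz (2 * i + 1))
| EvenStrand l i : f i = l -> e l.+1 = i.+1 ->
    strand (- Posz (2 * l + 2), Posz (2 * i + 2)).

Lemma strandsP s : strands e f s <-> strand s.
Proof.
split; last first.
  case=> [k h|k h|l i h h'|l i h h'];
    (split; first by rewrite /is_segment /=; lia); rewrite /= ?labelE //.
  - have -> : (2 * k + 3 = 2 * k.+1 + 1)%N by lia.
    by rewrite labelE h.
  - by rewrite h.
  - by rewrite h h'.
  - by rewrite h h'.
case: s => z w [] /= /and3P[/= z0 w0 zw].
case: (positionP z0) zw => i; case: (positionP w0) => j /=;
  rewrite !labelE => lt [h1 h2]; try lia.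
- have -> : (2 * j + 1 = 2 * i + 3)%N by lia.
  by constructor; rewrite h1 h2.
- by constructor.
- by move: (ef i j); lia.
- by move: (ef i.+1 j); lia.
- by constructor.
- by subst j; constructor.
Qed.

(** Instances of the adjunction at the end points show that no cup or cap shares
an end point with a transversal segment, and that of two transversal segments
the one ending further out above also ends further out below. *)
Lemma strands_nonoverlapping : nonoverlapping (strands e f).
Proof.
have disj (s t : int * int) :
    (s.2 < t.1) || (t.2 < s.1) -> seg_points s `&` seg_points t = set0.
  move=> h; apply/seteqP; split=> // z [[_ /andP[a b]] [_ /andP[c d]]].
  by move: h => /=; lia.
move=> s t Ds Dt st.
suff : [|| (s.2 < t.1), (t.2 < s.1), encloses s t | encloses t s].
  case/or4P => h; [apply: Or31|apply: Or31|apply: Or32|apply: Or33] => //;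
  by apply: disj => //; rewrite h ?orbT.
have {}st : (s.1 != t.1) || (s.2 != t.2).
  by rewrite -negb_and; apply: contra_notN st => /andP[/eqP a /eqP b];
    apply/eqP; rewrite -pair_eqE /pair_eq a b !eqxx.
move: st; case/strandsP: Dt => [k h|k h|l i h h'|l i h h'];
  case/strandsP: Ds => [k' g|k' g|l' i' g g'|l' i' g g'];
  rewrite /encloses /=; try lia.
- by move: (ef l' k) (ef l' k.+1); lia.
- by move: (ef l'.+1 k) (ef l'.+1 k.+1); lia.
- by move: (ef k i') (ef k.+1 i'); lia.
- by move: (ef k i') (ef k.+1 i'); lia.
- by move: (ef l k') (ef l k'.+1); lia.
- by move: (ef k' i) (ef k'.+1 i); lia.
- by move: (ef l i') (ef l' i); lia.
- by move: (ef l i') (ef l'.+1 i); lia.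
- by move: (ef l.+1 k') (ef l.+1 k'.+1); lia.
- by move: (ef k' i) (ef k'.+1 i); lia.
- by move: (ef l.+1 i') (ef l' i); lia.
- by move: (ef l.+1 i') (ef l'.+1 i); lia.
Qed.

Lemma strands_frieze : is_frieze (strands e f).
Proof.
split.
- by move=> s [].
- exact: strands_nonoverlapping.
- move=> z z0; have [w [w0 wz nwz]] := partner_exists z0.
  have [Dwz|Dzw] := strand_through w0 z0 wz nwz.
    by exists (w, z) => //; right.
  by exists (z, w) => //; left.
- move=> s /strandsP[k _|k _|l i _ _|l i _ _]; rewrite /cup /=; try lia.
  by exists k.
- move=> s /strandsP[k _|k _|l i _ _|l i _ _]; rewrite /cap /=; try lia.
  by exists k.
Qed.

(** f sends n + j to m + j and stays below m before n, so e sends m + j to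
n + j; the dots n + j and m + j are joined by a line that nothing else meets. *)
Lemma strands_type n m :
  (forall j, f (n + j) = m + j)%N -> (forall i, i < n -> f i < m)%N ->
  has_type (2 * n) (2 * m) (strands e f).
Proof.
move=> fhi flo k k0; apply/strandsP.
have ehi j : e (m + j)%N = (n + j)%N.
  apply/eqP; rewrite eqn_leq ef fhi leqnn /=.
  case: leqP => // lt; move: (leqnn (e (m + j))); rewrite ef.
  case: (leqP n (e (m + j))) => [nle|/flo]; last lia.
  by move: (fhi (e (m + j) - n)%N); rewrite subnKC //; lia.
case: (boolP (odd k)) => ok.
- have -> : (2 * m + k = 2 * (m + k./2) + 1)%N by lia.
  have -> : (2 * n + k = 2 * (n + k./2) + 1)%N by lia.
  by constructor.
- have -> : (2 * m + k = 2 * (m + k.-1./2) + 2)%N by lia.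
  have -> : (2 * n + k = 2 * (n + k.-1./2) + 2)%N by lia.
  by constructor => //; rewrite -addnS ehi addnS.
Qed.

(** The transversal pair with bottom dot k is formed by the left side of the
least dot and the right side of the greatest dot of the fibre of f over k, so
it covers exactly that fibre. *)
Lemma phi_strands i : phi (strands e f) i = f i.
Proof.
rewrite /phi; case: xgetP => [k _|none].
  case=> k2 [k3] [[[_ /= sE] [[_ /= tE] _ _ _]] ki].
  have {}sE : f k2 = k by move: sE; rewrite !labelE => -[].
  have {}tE : f (k2 + k3)%N = k.
    by move: tE; rewrite -mulnDr !labelE => -[].
  have := galois_homo_upper ef (proj1 (andP ki)).
  have := galois_homo_upper ef (proj2 (andP ki)).
  lia.
exfalso; apply: (none (f i)).
have lo := ef (f i) i; have hi := ef (f i).+1 i.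
exists (e (f i)), (e (f i).+1 - (e (f i)).+1)%N; split; last lia.
have flo : f (e (f i)) = f i.
  apply/eqP; rewrite eqn_leq -[X in _ && X]ef leqnn andbT.
  by rewrite (galois_homo_upper ef) //; lia.
have fhi : f (e (f i).+1).-1 = f i.
  apply/eqP; rewrite eqn_leq -ltnS; apply/andP; split.
    by move: (ef (f i).+1 (e (f i).+1).-1); lia.
  by rewrite -ef; lia.
split; first by apply/strandsP; constructor.
have tE : (2 * e (f i) + 2 * (e (f i).+1 - (e (f i)).+1) + 2
   = 2 * (e (f i).+1).-1 + 2)%N by lia.
split => /=.
- by rewrite tE; apply/strandsP; constructor; rewrite ?fhi //; lia.
- by rewrite /Defs.transversal /=; lia.
- lia.
- move=> u /strandsP[c h|c h|l j h h'|l j h h'];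
    rewrite /Defs.transversal /=; try lia.
  + by move: (ef (f i).+1 j) (ef l (e (f i))); lia.
  + move=> _ jlt; have fil : (f i < l.+1)%N by move: (ef (f i) j); lia.
    by have := galois_homo_lower ef fil; lia.
Qed.
End StrandsFrieze.

(** The labels of f = id are (i, i) and (i, i+1) on both lines. *)
Lemma strands_id : strands id id = unit_frieze.
Proof.
have idP : galois id id by [].
apply/seteqP; split=> s.
  case/strandsP => // [k|k|l i <- _|l i <- _]; try lia.
  - by exists (2 * i + 1)%N => //; lia.
  - by exists (2 * i + 2)%N => //; lia.
case=> k k0 ->; split; first by rewrite /is_segment /=; lia.
by rewrite /label /= ifF ?ifT ?abszN //; lia.
Qed.

(** * Composition of strands *)

Section Composition.
Variables ef f eg g : nat -> nat.
Hypotheses (fP : galois ef f) (gP : galois eg g).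
Local Notation D1 := (strands ef f).
Local Notation D2 := (strands eg g).
Local Notation lab := (label (ef \o eg) (g \o f)).

(** The label of g o f, extended to the middle points by their common image
under the labels of f and of g. *)
Definition point_label (p : Defs.point) : nat * nat :=
  match p with
  | Top k => (g (f k.-1./2), uphalf k.-1)
  | Middle k => (g k.-1./2, ef (uphalf k.-1))
  | Bottom k => (k.-1./2, ef (eg (uphalf k.-1)))
  end.

Lemma point_label_upper z :
  point_label (upper_point z) = (g (label ef f z).1, (label ef f z).2).
Proof. by rewrite /upper_point /label; case: ifP. Qed.

Lemma point_label_lower z :
  point_label (lower_point z) = ((label eg g z).1, ef (label eg g z).2).
Proof. by rewrite /lower_point /label; case: ifP. Qed.

Lemma point_label_outer z : point_label (outer_point z) = lab z.
Proof. by rewrite /outer_point /label; case: ifP. Qed.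

Lemma connected_label p q : connected D2 D1 p q ->
  point_label p = point_label q.
Proof.
elim=> [{}p {}q [] [s [_ sE]] [-> ->]||? ? _ ->|? ? ? _ -> _ ->] //.
  by rewrite !point_label_upper sE.
by rewrite !point_label_lower sE.
Qed.

Local Notation conn := (connected D2 D1).

Lemma connected_upper z w : z != 0 -> w != 0 ->
  label ef f z = label ef f w -> conn (upper_point z) (upper_point w).
Proof.
move=> z0 w0 zw; have [->|nzw] := eqVneq z w; first exact: rst_refl.
have [D|D] := strand_through z0 w0 zw nzw.
  by apply: rst_step; left; exists (z, w).
by apply/rst_sym/rst_step; left; exists (w, z).
Qed.

Lemma connected_lower z w : z != 0 -> w != 0 ->
  label eg g z = label eg g w -> conn (lower_point z) (lower_point w).
Proof.
move=> z0 w0 zw; have [->|nzw] := eqVneq z w; first exact: rst_refl.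
have [D|D] := strand_through z0 w0 zw nzw.
  by apply: rst_step; right; exists (z, w).
by apply/rst_sym/rst_step; right; exists (w, z).
Qed.

(** The two sides of a middle dot are joined by a cap of f, and the gap between
two dots is closed by a cup of g. *)
Lemma connected_middle_next p :
  point_label (Middle p.+1) = point_label (Middle p.+2) ->
  conn (Middle p.+1) (Middle p.+2).
Proof.
move=> [h1 h2]; case: (boolP (odd p)) => op.
- have := @connected_lower (Posz p.+1) (Posz p.+2) isT isT.
  by apply; rewrite /label /= h1; congr (_, _); lia.
- have := @connected_upper (- Posz p.+1) (- Posz p.+2) isT isT.
  by apply; rewrite /label /= h2; congr (_, _); lia.
Qed.

(** Both coordinates of the label are nondecreasing along the middle line, so
every middle point between p and q has their common label. *)
Lemma connected_middle p q :
  point_label (Middle p.+1) = point_label (Middle q.+1) ->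
  conn (Middle p.+1) (Middle q.+1).
Proof.
wlog pq : p q / (p <= q)%N => [wl|].
  by case: (leqP p q) => [/wl//|/ltnW/wl wl' h]; apply/rst_sym/wl'.
rewrite -(subnKC pq); elim: (q - p)%N => [|d IH].
  by rewrite addn0 => _; apply: rst_refl.
rewrite addnS => h.
have step : point_label (Middle (p + d).+1) = point_label (Middle (p + d).+2).
  case: h => /= h1 h2; congr (_, _).
  - have := galois_homo_upper gP (half_leq (leq_addr d p)).
    have := galois_homo_upper gP (half_leq (leqnSn (p + d))).
    by rewrite /=; lia.
  - have := galois_homo_lower fP (uphalf_leq (leq_addr d p)).
    have := galois_homo_lower fP (uphalf_leq (leqnSn (p + d))).
    by rewrite /=; lia.
apply: (rst_trans _ _ _ _ _ (IH _) (connected_middle_next step)).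
by rewrite step.
Qed.

(** An outer point either is joined to the middle line by its own segment, or
that segment is already a cup of f or a cap of g. *)
Lemma outer_reach z : z != 0 ->
  (exists w, [/\ w != 0, w != z, lab w = lab z &
     conn (outer_point w) (outer_point z)]) \/
  (exists p, conn (Middle p.+1) (outer_point z)).
Proof.
move=> z0.
have out w : conn (outer_point w) (outer_point z) -> lab w = lab z.
  by move/connected_label; rewrite !point_label_outer.
case: (ltrP 0 z) => zs.
- have [w [w0 lw wz]] := partner_exists fP z0.
  have := connected_upper w0 z0 lw.
  rewrite {2}/upper_point zs /upper_point;
  case: (ltrP 0 w) => ws c; [left|right].
    have cc : conn (outer_point w) (outer_point z).
      by rewrite /outer_point ws zs.
    by exists w; split=> //; apply: out.
  exists `|w|%N.-1; rewrite prednK; last lia.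
  by rewrite /outer_point zs.
- have zF : (0 < z) = false by lia.
  have [w [w0 lw wz]] := partner_exists gP z0.
  have := connected_lower w0 z0 lw.
  rewrite {2}/lower_point zF /lower_point;
  case: (ltrP 0 w) => ws c; [right|left].
    exists `|w|%N.-1; rewrite prednK; last lia.
    by rewrite /outer_point zF.
  have cc : conn (outer_point w) (outer_point z).
    by rewrite /outer_point zF ifF //; lia.
  by exists w; split=> //; apply: out.
Qed.

(** Only two outer points can share a label, so a point whose segment stays on
its own side can have no other mate; all the rest meet on the middle line. *)
Lemma label_connected z w : z != 0 -> w != 0 -> lab z = lab w ->
  conn (outer_point z) (outer_point w).
Proof.
move=> z0 w0 zw; have [->|nzw] := eqVneq z w; first exact: rst_refl.
have gfP := galois_comp fP gP.
case: (outer_reach z0) => [[v [v0 vz lv c]]|[p cp]].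
  have -> : w = v by apply: (label_third gfP z0 w0 v0) => //; rewrite eq_sym.
  exact: rst_sym.
case: (outer_reach w0) => [[v [v0 vw lv c]]|[q cq]].
  have -> : z = v by apply: (label_third gfP w0 z0 v0) => //; rewrite eq_sym.
  exact: c.
apply: rst_trans (rst_sym _ _ _ _ cp) _.
apply: (rst_trans _ _ _ _ _ _ cq); apply: connected_middle.
by rewrite (connected_label cp) (connected_label cq) !point_label_outer.
Qed.

Lemma strands_comp : frieze_comp D2 D1 = strands (ef \o eg) (g \o f).
Proof.
apply/seteqP; split=> s [sg h]; split=> //.
  by move/connected_label: h; rewrite !point_label_outer.
by case/and3P: sg => s1 s2 _; apply: label_connected.
Qed.
End Composition.

(** * Recovering the order-preserving map from a frieze *)

(** A row with a crossing contains exactly one, and it comes before q when the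
row comes before p. *)
Lemma matching_count_row (T : rel nat) :
  (forall p q p' q', T p q -> T p' q' -> (p < p') = (q < q'))%N ->
  forall p q i, T p q -> (i < p)%N ->
  `[<exists j, T i j>] = (\sum_(j < q) T i j)%N :> nat.
Proof.
move=> Tm p q i Tpq ip; case: asboolP => [[j Tij]|none].
  have jq : (j < q)%N by rewrite -(Tm _ _ _ _ Tij Tpq).
  rewrite (bigD1 (Ordinal jq)) //= Tij big1 // => k /eqP kj.
  case Tik: (T i k) => //; case: kj; apply/val_inj => /=.
  by move: (Tm _ _ _ _ Tij Tik) (Tm _ _ _ _ Tik Tij); lia.
rewrite big1 // => j _; case Tij: (T i j) => //.
by case: none; exists j.
Qed.

(** In an order-preserving matching, matched points have equally many matched
predecessors: both sums count the crossings below (p, q). *)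
Lemma matching_count (T : rel nat) :
  (forall p q p' q', T p q -> T p' q' -> (p < p') = (q < q'))%N ->
  forall p q, T p q ->
  (\sum_(i < p) `[<exists j, T i j>] = \sum_(j < q) `[<exists i, T i j>])%N.
Proof.
move=> Tm p q Tpq.
rewrite (eq_bigr (fun i : 'I_p => \sum_(j < q) T i j)%N) => [|i _]; last first.
  exact: matching_count_row Tpq _.
rewrite exchange_big; apply: eq_bigr => j _.
rewrite (@matching_count_row (fun j i => T i j) _ q p) //.
by move=> q' p' q'' p'' T' T''; rewrite (Tm _ _ _ _ T' T'').
Qed.

Section FriezeShape.
Variable D : set (int * int).
Hypothesis DF : is_frieze D.

(** Disjoint segments and segments enclosing one another share no end point. *)
Lemma frieze_end_unique s t z : D s -> D t ->
  z = s.1 \/ z = s.2 -> z = t.1 \/ z = t.2 -> s = t.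
Proof.
move=> Ds Dt zs zt; have [//|/eqP st] := eqVneq s t.
have sg := frieze_segment DF Ds; have tg := frieze_segment DF Dt.
have := frieze_nonoverlapping DF Ds Dt st.
case: s t zs zt sg tg {st Ds Dt} => [a b] [c d] /= zs zt.
rewrite /is_segment /encloses /= => sg tg.
case=> [st0|/andP[]|/andP[]]; try lia.
have : (seg_points (a, b) `&` seg_points (c, d)) z.
  by rewrite /seg_points /=; split; split; lia.
by rewrite st0.
Qed.

Variant frieze_segment_spec : int * int -> Prop :=
| FriezeCup k : frieze_segment_spec (Posz (2 * k + 2), Posz (2 * k + 3))
| FriezeCap k : frieze_segment_spec (- Posz (2 * k + 2), - Posz (2 * k + 1))
| FriezeTransversal p q : frieze_segment_spec (- Posz q.+1, Posz p.+1).

Lemma frieze_segmentP s : D s -> frieze_segment_spec s.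
Proof.
move=> Ds; have sg := frieze_segment DF Ds.
case: (boolP (cup s)) => [/(frieze_cup DF Ds)[k ->]|ncup]; first by constructor.
case: (boolP (cap s)) => [/(frieze_cap DF Ds)[k ->]|ncap]; first by constructor.
case: s sg ncup ncap {Ds} => a b.
rewrite /is_segment /cup /cap /= => sg ncup ncap.
have -> : a = - Posz `|a|%N.-1.+1 by lia.
have -> : b = Posz `|b|%N.-1.+1 by lia.
by constructor.
Qed.

(** The arguments number the points from 0: p is the top point p+1 and
q the bottom point q+1. *)
Definition crossing : rel nat := fun p q => `[<D (- Posz q.+1, Posz p.+1)>].

(** Two distinct transversal segments both contain 1, so one encloses the other. *)
Lemma crossing_monotone p q p' q' :
  crossing p q -> crossing p' q' -> (p < p')%N = (q < q')%N.
Proof.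
move=> /asboolP Ds /asboolP Dt.
have [[h1 h2]|/eqP st] :=
  eqVneq (- Posz q.+1, Posz p.+1) (- Posz q'.+1, Posz p'.+1).
  lia.
case: (frieze_nonoverlapping DF Ds Dt st); rewrite /encloses /=; try lia.
move=> st0; suff : (seg_points (- Posz q.+1, Posz p.+1) `&`
  seg_points (- Posz q'.+1, Posz p'.+1)) 1 by rewrite st0.
by rewrite /seg_points /=; split; split; lia.
Qed.

Definition top_crossed p := `[<exists q, crossing p q>].
Definition bottom_crossed q := `[<exists p, crossing p q>].
Definition cupped k := `[<D (Posz (2 * k + 2), Posz (2 * k + 3))>].
Definition capped k := `[<D (- Posz (2 * k + 2), - Posz (2 * k + 1))>].

Lemma top_crossedP p : ~~ top_crossed p <->
  exists2 k, cupped k & p = (2 * k + 1)%N \/ p = (2 * k + 2)%N.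
Proof.
split=> [/asboolP np|[k /asboolP Dk pk]].
  have [s Ds ps] := frieze_exhausts DF (isT : Posz p.+1 != 0).
  case: (frieze_segmentP Ds) (Ds) ps => {Ds}[k|k|p' q] Ds /= ps.
  - by exists k; [apply/asboolP | lia].
  - lia.
  - by case: np; exists q; apply/asboolP; have -> : p = p' by lia.
apply/asboolP => -[q /asboolP Dq].
suff : (- Posz q.+1, Posz p.+1)
  = (Posz (2 * k + 2), Posz (2 * k + 3)) by case; lia.
by apply: (frieze_end_unique (z := Posz p.+1) Dq Dk); rewrite /=; lia.
Qed.

Lemma bottom_crossedP q : ~~ bottom_crossed q <->
  exists2 k, capped k & q = (2 * k)%N \/ q = (2 * k + 1)%N.
Proof.
split=> [/asboolP nq|[k /asboolP Dk qk]].
  have [s Ds qs] := frieze_exhausts DF (isT : - Posz q.+1 != 0).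
  case: (frieze_segmentP Ds) (Ds) qs => {Ds}[k|k|p q'] Ds /= qs.
  - lia.
  - by exists k; [apply/asboolP | lia].
  - by case: nq; exists p; apply/asboolP; have -> : q = q' by lia.
apply/asboolP => -[p /asboolP Dp].
suff : (- Posz q.+1, Posz p.+1)
  = (- Posz (2 * k + 2), - Posz (2 * k + 1)) by case; lia.
by apply: (frieze_end_unique (z := - Posz q.+1) Dp Dk); rewrite /=; lia.
Qed.

Lemma top_crossed0 : top_crossed 0.
Proof. by apply: contraT => /top_crossedP[k _]; lia. Qed.

Lemma top_crossed_odd k : top_crossed (2 * k + 1) = ~~ cupped k.
Proof.
rewrite -[LHS]negbK; congr (~~ _).
apply/idP/idP => [/top_crossedP[k' ck kk]|ck].
  by have -> : k = k' by lia.
by apply/top_crossedP; exists k; [|left].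
Qed.

Lemma top_crossed_even k : top_crossed (2 * k + 2) = ~~ cupped k.
Proof.
rewrite -[LHS]negbK; congr (~~ _).
apply/idP/idP => [/top_crossedP[k' ck kk]|ck].
  by have -> : k = k' by lia.
by apply/top_crossedP; exists k; [|right].
Qed.

Lemma bottom_crossed_even k : bottom_crossed (2 * k) = ~~ capped k.
Proof.
rewrite -[LHS]negbK; congr (~~ _).
apply/idP/idP => [/bottom_crossedP[k' ck kk]|ck].
  by have -> : k = k' by lia.
by apply/bottom_crossedP; exists k; [|left].
Qed.

Lemma bottom_crossed_odd k : bottom_crossed (2 * k + 1) = ~~ capped k.
Proof.
rewrite -[LHS]negbK; congr (~~ _).
apply/idP/idP => [/bottom_crossedP[k' ck kk]|ck].
  by have -> : k = k' by lia.
by apply/bottom_crossedP; exists k; [|right].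
Qed.

(** Each cup or cap removes two consecutive points, so the crossed points among
the first ones of a line are counted by the cups or caps that are absent. *)
Definition uncupped i := (\sum_(k < i) ~~ cupped k)%N.
Definition uncapped l := (\sum_(k < l) ~~ capped k)%N.

Lemma uncuppedS i : uncupped i.+1 = (uncupped i + ~~ cupped i)%N.
Proof. exact: big_ord_recr. Qed.

Lemma uncappedS l : uncapped l.+1 = (uncapped l + ~~ capped l)%N.
Proof. exact: big_ord_recr. Qed.

Lemma top_crossed_count i :
  (\sum_(p < 2 * i + 1) top_crossed p = 2 * uncupped i + 1)%N.
Proof.
elim: i => [|i IH].
  by rewrite muln0 big_ord_recr big_ord0 /= top_crossed0 /uncupped big_ord0.
have -> : (2 * i.+1 + 1 = (2 * i + 1).+2)%N by lia.
rewrite !big_ord_recr /= IH uncuppedS top_crossed_odd -addnS top_crossed_even.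
lia.
Qed.

Lemma bottom_crossed_count l :
  (\sum_(q < 2 * l) bottom_crossed q = 2 * uncapped l)%N.
Proof.
elim: l => [|l IH]; first by rewrite muln0 /uncapped !big_ord0.
have -> : (2 * l.+1 = (2 * l).+2)%N by lia.
rewrite !big_ord_recr /= IH uncappedS bottom_crossed_even.
rewrite -[X in bottom_crossed X]addn1 bottom_crossed_odd.
lia.
Qed.

(** The ends of a transversal segment have the same parity, and the same number
of absent cups and caps before them. *)
Variant transversal_spec : nat -> nat -> Prop :=
| OddTransversal i l : uncupped i = uncapped l -> top_crossed (2 * i) ->
    ~~ capped l -> transversal_spec (2 * i) (2 * l)
| EvenTransversal i l : uncupped i = uncapped l -> ~~ cupped i ->
    ~~ capped l -> transversal_spec (2 * i + 1) (2 * l + 1).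

Lemma crossingP p q : crossing p q -> transversal_spec p q.
Proof.
move=> c; have := matching_count crossing_monotone c.
have tp : top_crossed p by apply/asboolP; exists q.
have bq : bottom_crossed q by apply/asboolP; exists p.
have even_count i : top_crossed (2 * i) ->
    (\sum_(p < 2 * i) top_crossed p = 2 * uncupped i)%N.
  move=> ti; have := top_crossed_count i.
  by rewrite addn1 big_ord_recr /= ti; lia.
have odd_count l : bottom_crossed (2 * l) ->
    (\sum_(q < 2 * l + 1) bottom_crossed q = 2 * uncapped l + 1)%N.
  by move=> bl; rewrite addn1 big_ord_recr /= bottom_crossed_count bl addn1.
have parity r : r = (2 * r./2)%N \/ r = (2 * r./2 + 1)%N by lia.
rewrite -/(top_crossed _) -/(bottom_crossed _).
case: (parity p) tp => ->; case: (parity q) bq => ->.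
- rewrite bottom_crossed_even => bq tp.
  rewrite even_count // bottom_crossed_count => ab.
  by constructor => //; lia.
- rewrite bottom_crossed_odd => bq tp.
  rewrite even_count // odd_count ?bottom_crossed_even //; lia.
- rewrite bottom_crossed_even => bq tp.
  rewrite top_crossed_count bottom_crossed_count; lia.
- rewrite bottom_crossed_odd top_crossed_odd => bq tp.
  rewrite top_crossed_count odd_count ?bottom_crossed_even // => ab.
  by constructor => //; lia.
Qed.

End FriezeShape.

(** Every point is an end point of exactly one segment in each frieze. *)
Lemma frieze_sub_eq D D' : is_frieze D -> is_frieze D' -> D `<=` D' -> D = D'.
Proof.
move=> DF DF' sub; apply/seteqP; split=> // s Ds.
have /and3P[s1 _ _] := frieze_segment DF' Ds.
have [t Dt st] := frieze_exhausts DF s1.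
by rewrite (frieze_end_unique DF' (z := s.1) Ds (sub _ Dt)) //; left.
Qed.

(** Here b may be constant on intervals; f i is the greatest l with b l <= a i,
which lies just before the first l with b l > a i. *)
Lemma galois_of_counts (a b : nat -> nat) :
  {homo a : i j / (i <= j)%N} -> {homo b : i j / (i <= j)%N} ->
  (forall x, exists i, x <= a i)%N -> (forall x, exists l, x <= b l)%N ->
  b 0%N = 0%N ->
  exists e f, galois e f /\ forall l i, (l <= f i)%N = (b l <= a i)%N.
Proof.
move=> am bm au bu b0.
have [a' a'P] := galois_exists am au; have [b' b'P] := galois_exists bm bu.
exists (a' \o b), (fun i => (b' (a i).+1).-1).
have fP l i : (l <= (b' (a i).+1).-1)%N = (b l <= a i)%N.
  by have := b'P (a i).+1 0%N; have := b'P (a i).+1 l; rewrite b0; lia.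
by split=> // l i; rewrite fP a'P.
Qed.

(** Finite type bounds the cups and caps, so the counts a and b of absent ones
are unbounded and define f and e. It then suffices that every segment of D is a
strand of f, as a frieze contained in another one equals it. *)
Lemma frieze_strands n m D : is_frieze D -> has_type (2 * n) (2 * m) D ->
  exists e f, [/\ galois e f, D = strands e f,
    forall j, f (n + j)%N = (m + j)%N & forall i, (i < n)%N -> (f i < m)%N].
Proof.
move=> DF Dtype.
have ncup j : ~~ cupped D (n + j).
  rewrite -top_crossed_odd //; apply/asboolP; exists (2 * (m + j) + 1)%N.
  apply/asboolP; have := Dtype (2 * j + 2)%N; rewrite addn2 => /(_ isT).
  by congr (D (- Posz _, Posz _)); lia.
have ncap j : ~~ capped D (m + j).
  rewrite -bottom_crossed_odd //; apply/asboolP; exists (2 * (n + j) + 1)%N.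
  apply/asboolP; have := Dtype (2 * j + 2)%N; rewrite addn2 => /(_ isT).
  by congr (D (- Posz _, Posz _)); lia.
have [] := @galois_of_counts (uncupped D) (uncapped D).
- apply: homo_leq => // [x y z|i]; first exact: leq_trans.
  by rewrite uncuppedS leq_addr.
- apply: homo_leq => // [x y z|i]; first exact: leq_trans.
  by rewrite uncappedS leq_addr.
- move=> x; exists (n + x)%N; elim: x => // x IH.
  by rewrite addnS uncuppedS ncup addn1.
- move=> x; exists (m + x)%N; elim: x => // x IH.
  by rewrite addnS uncappedS ncap addn1.
- by rewrite /uncapped big_ord0.
move=> e [f [ef fE]].
have aS := uncuppedS D; have bS := uncappedS D.
have DE : D = strands e f.
  apply: frieze_sub_eq => //; first exact: strands_frieze.
  move=> s Ds; apply/(strandsP ef).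
  case: (frieze_segmentP DF Ds) (Ds) => {Ds}[k|k|p q] Ds.
  - constructor; have := aS k; have -> : cupped D k by apply/asboolP.
    rewrite addn0 => ak; move: (fE (f k) k) (fE (f k) k.+1).
    by move: (fE (f k.+1) k) (fE (f k.+1) k.+1); rewrite ak; lia.
  - constructor; have := bS k; have -> : capped D k by apply/asboolP.
    rewrite addn0 => bk; have ek i : (e k <= i)%N = (e k.+1 <= i)%N.
      by rewrite !ef !fE bk.
    by move: (ek (e k)) (ek (e k.+1)); lia.
  - have c : crossing D p q by apply/asboolP.
    case: {Ds} (crossingP DF c) => i l ab ti bl.
    + have fi : f i = l.
        by move: (fE l i) (fE l.+1 i) (bS l); rewrite bl; lia.
      have -> : (2 * l).+1 = (2 * l + 1)%N by lia.
      have -> : (2 * i).+1 = (2 * i + 1)%N by lia.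
      constructor => //; have := ef l i; rewrite fi leqnn => eli.
      apply/eqP; rewrite eqn_leq eli; case: i {c fi eli} ab ti => // i ab.
      have -> : (2 * i.+1 = 2 * i + 2)%N by lia.
      rewrite top_crossed_even // => ti.
      by move: (ef l i) (fE l i) (aS i); rewrite ti; lia.
    + have fi : f i = l.
        by move: (fE l i) (fE l.+1 i) (bS l); rewrite bl; lia.
      rewrite -!addnS; constructor => //.
      move: (ef l.+1 i) (fE l.+1 i) (ef l.+1 i.+1) (fE l.+1 i.+1) (aS i) (bS l).
      by rewrite ti bl; lia.
exists e, f.
(* The segments prescribed by the type give the values of f and e beyond n and
   m; then e m = n says that f i < m exactly when i < n. *)
have hi j : f (n + j)%N = (m + j)%N /\ e (m + j)%N = (n + j)%N.
  have := Dtype (2 * j).+1 isT; rewrite DE => -[_ /=].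
  have -> : (2 * m + (2 * j).+1 = 2 * (m + j) + 1)%N by lia.
  have -> : (2 * n + (2 * j).+1 = 2 * (n + j) + 1)%N by lia.
  by rewrite !labelE => -[-> ->].
split=> // [j|i ni]; first by case: (hi j).
have [_] := hi 0%N; rewrite !addn0 => em.
by rewrite ltnNge -ef em -ltnNge.
Qed.

(** * The isomorphism of categories *)

(** Arrows with different ends are compared through an invariant u that is
faithful on each hom-set, which avoids transporting arrows along equalities of
objects. *)
Lemma functor_ext (ob1 : Type) (hom1 : ob1 -> ob1 -> Type) (C : category hom1)
    (ob2 : Type) (hom2 : ob2 -> ob2 -> Type) (D : category hom2)
    (U : Type) (u : forall x y, hom2 x y -> U) (F G : functor C D) :
  (forall x y (h h' : hom2 x y), u x y h = u x y h' -> h = h') ->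
  (forall x, F x = G x) ->
  (forall x y (h : hom1 x y), u _ _ (on_hom F h) = u _ _ (on_hom G h)) ->
  F = G.
Proof.
move=> uinj; case: F G => [o h hid hcomp] [o' h' hid' hcomp'] /= /funext oo'.
case: _ / oo' h' hid' hcomp' => h' hid' hcomp' hh'.
have {}hh' : h = h'.
  by apply/functional_extensionality_dep => x;
     apply/functional_extensionality_dep => y; apply/funext => a; apply: uinj.
by case: _ / hh' hid' hcomp' => hid' hcomp';
  congr Functor; apply: Prop_irrelevance.
Qed.

Section Extension.
Variables n m : nat.

(** Past n the map is continued by the translation n + j |-> m + j, which is
what the segments [-(2m+k), 2n+k] of a frieze of type (2n, 2m) do to phi. *)
Definition extend (f : delta_hom n m) (i : nat) : nat :=
  if insub i is Some j then nat_of_ord (f j) else (m + (i - n))%N.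

Lemma extend_ord f (i : 'I_n) : extend f i = f i.
Proof. by rewrite /extend valK. Qed.

Lemma extend_ge f j : extend f (n + j) = (m + j)%N.
Proof. by rewrite /extend insubF ?addKn // ltnNge leq_addr. Qed.

Lemma extend_lt f i : (i < n)%N -> (extend f i < m)%N.
Proof. by move=> ni; rewrite (extend_ord f (Ordinal ni)). Qed.

Lemma extend_inj f g : extend f = extend g -> f = g.
Proof.
move=> fg; apply: delta_hom_eq => i; apply/val_inj => /=.
by rewrite -!extend_ord fg.
Qed.

Lemma extend_homo f : {homo extend f : i j / (i <= j)%N}.
Proof.
move=> i j ij; case: (ltnP j n) => [jn|nj].
  have i_n := leq_ltn_trans ij jn.
  rewrite (extend_ord f (Ordinal i_n)) (extend_ord f (Ordinal jn)).
  exact: (delta_mono f).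
rewrite -(subnKC nj) extend_ge.
case: (ltnP i n) => [/(extend_lt f)|ni]; first lia.
by rewrite -(subnKC ni) extend_ge; lia.
Qed.

Lemma extend_galois f : exists e, galois e (extend f).
Proof.
apply: galois_exists; first exact: extend_homo.
by move=> l; exists (n + l)%N; rewrite extend_ge leq_addl.
Qed.
End Extension.

Lemma extend_id n : extend (delta_id n) = id.
Proof.
apply/funext => i; case: (ltnP i n) => [ni|ni].
  exact: (extend_ord _ (Ordinal ni)).
by rewrite -(subnKC ni) extend_ge.
Qed.

Lemma extend_comp n m p (g : delta_hom m p) (f : delta_hom n m) :
  extend (delta_comp g f) = extend g \o extend f.
Proof.
apply/funext => i; case: (ltnP i n) => [ni|ni] /=.
  rewrite !(extend_ord _ (Ordinal ni)) /=.
  by rewrite extend_ord.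
by rewrite -(subnKC ni) !extend_ge.
Qed.

Lemma even_half (x : even_nat) : (2 * x./2)%N = x.
Proof. by case: x => x /= xe; lia. Qed.

Lemma even_nat_inj (x y : even_nat) : even_val x = even_val y -> x = y.
Proof.
case: x y => [x xe] [y ye] /= xy; subst y.
by congr EvenNat; apply: bool_irrelevance.
Qed.

Lemma frieze_hom_inj (x y : even_nat) (D D' : frieze_hom x y) :
  D = D' :> set (int * int) -> D = D'.
Proof.
case: D D' => [D DF Dt] [D' DF' Dt'] /= DD'; subst D'.
by congr FriezeHom; apply: Prop_irrelevance.
Qed.

Lemma frieze_homP (x y : even_nat) (D : frieze_hom x y) :
  exists e f, [/\ galois e f, D = strands e f :> set (int * int),
    forall j, f (x./2 + j)%N = (y./2 + j)%N &
    forall i, (i < x./2)%N -> (f i < y./2)%N].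
Proof.
apply: frieze_strands; first exact: frieze_ofP.
by rewrite !even_half; apply: frieze_of_type.
Qed.

(** A frieze of strands is determined by f, as e is determined by f. The types
of the two friezes may differ: this is used when comparing an object x with the
double of its half. *)
Lemma phi_inj (x y x' y' : even_nat) (D : frieze_hom x y)
    (D' : frieze_hom x' y') :
  phi D = phi D' -> D = D' :> set (int * int).
Proof.
have [e [f [ef -> _ _]]] := frieze_homP D.
have [e' [f' [ef' -> _ _]]] := frieze_homP D'.
move=> ff'; have {}ff' : f = f'.
  by apply/funext => i; rewrite -(phi_strands ef) -(phi_strands ef') ff'.
by subst f'; rewrite (galois_lower_unique ef ef').
Qed.

Lemma unit_frieze_frieze : is_frieze unit_frieze.
Proof. by rewrite -strands_id; apply: strands_frieze. Qed.

Lemma unit_frieze_type n : has_type n n unit_frieze.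
Proof. by move=> k k0; exists (n + k)%N => //; lia. Qed.

Definition unit_hom (x : even_nat) : frieze_hom x x :=
  FriezeHom unit_frieze_frieze (unit_frieze_type x).

Lemma phi_unit (x : even_nat) : phi (unit_hom x) = id.
Proof. by apply/funext => i; rewrite /= -strands_id phi_strands. Qed.

Section CompHom.
Variables (x y z : even_nat) (D2 : frieze_hom y z) (D1 : frieze_hom x y).

Lemma frieze_comp_frieze : is_frieze (frieze_comp D2 D1).
Proof.
have [e1 [f1 [ef1 -> _ _]]] := frieze_homP D1.
have [e2 [f2 [ef2 -> _ _]]] := frieze_homP D2.
by rewrite strands_comp //; apply/strands_frieze/galois_comp.
Qed.

Lemma frieze_comp_type : has_type x z (frieze_comp D2 D1).
Proof.
have [e1 [f1 [ef1 -> hi1 lo1]]] := frieze_homP D1.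
have [e2 [f2 [ef2 -> hi2 lo2]]] := frieze_homP D2.
rewrite strands_comp // -(even_half x) -(even_half z).
apply: strands_type; first exact: galois_comp.
- by move=> j /=; rewrite hi1 hi2.
- by move=> i /lo1/lo2.
Qed.

Definition comp_hom : frieze_hom x z :=
  FriezeHom frieze_comp_frieze frieze_comp_type.

Lemma phi_comp : phi comp_hom = phi D2 \o phi D1.
Proof.
have [e1 [f1 [ef1 D1E _ _]]] := frieze_homP D1.
have [e2 [f2 [ef2 D2E _ _]]] := frieze_homP D2.
rewrite /= D1E D2E strands_comp //; apply/funext => i /=.
by rewrite !phi_strands //; apply: galois_comp.
Qed.
End CompHom.

Definition frieze_category : category frieze_hom.
Proof.
refine (@Category even_nat frieze_hom unit_hom comp_hom _ _ _) => *;
  by apply/frieze_hom_inj/phi_inj; rewrite !phi_comp ?phi_unit.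
Defined.

Section Restriction.
Variables (x y : even_nat) (D : frieze_hom x y).

Lemma phi_lt (i : 'I_x./2) : (phi D i < y./2)%N.
Proof.
have [e [f [ef -> _ lo]]] := frieze_homP D.
by rewrite phi_strands //; apply: lo.
Qed.

Definition restrict_fun (i : 'I_x./2) : 'I_y./2 := Ordinal (phi_lt i).

Lemma restrict_homo : {homo restrict_fun : i j / (i <= j)%N}.
Proof.
move=> i j ij /=; have [e [f [ef -> _ _]]] := frieze_homP D.
by rewrite !phi_strands //; apply: (galois_homo_upper ef).
Qed.

Definition restrict : delta_hom x./2 y./2 := DeltaHom restrict_homo.

Lemma extend_restrict : extend restrict = phi D.
Proof.
apply/funext => i; case: (ltnP i x./2) => [ix|xi].
  exact: (extend_ord _ (Ordinal ix)).
rewrite -(subnKC xi) extend_ge; have [e [f [ef -> hi _]]] := frieze_homP D.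
by rewrite phi_strands // hi.
Qed.
End Restriction.

Definition restriction : functor frieze_category Delta.
Proof.
refine (@Functor _ _ frieze_category _ _ Delta
  (fun x => x./2) restrict _ _) => [x|x y z D2 D1]; apply: extend_inj.
- by rewrite extend_restrict phi_unit extend_id.
- by rewrite extend_restrict phi_comp extend_comp !extend_restrict.
Defined.

Section Realization.
Variables (n m : nat) (f : delta_hom n m).

Definition realize_set : set (int * int) :=
  strands (sval (cid (extend_galois f))) (extend f).

Let ef := svalP (cid (extend_galois f)).

Lemma realize_type : has_type (twice n) (twice m) realize_set.
Proof.
by apply: (strands_type ef); [exact: extend_ge | exact: extend_lt].
Qed.

Definition realize : frieze_hom (twice n) (twice m) :=
  FriezeHom (strands_frieze ef : is_frieze realize_set) realize_type.

Lemma phi_realize : phi realize = extend f.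
Proof. by apply/funext => i; apply: phi_strands. Qed.
End Realization.

Definition realization : functor Delta frieze_category.
Proof.
refine (@Functor _ _ Delta _ _ frieze_category
  twice realize _ _) => [n|n m p g f]; apply/frieze_hom_inj/phi_inj.
- by rewrite phi_realize extend_id phi_unit.
- by rewrite phi_comp !phi_realize extend_comp.
Defined.

Lemma half_twice n : (twice n)./2 = n.
Proof. by rewrite /= mul2n doubleK. Qed.

Theorem mainTheorem12 :
  exists DB : category frieze_hom,
    (forall n : even_nat, frieze_of (identity DB n) = unit_frieze) /\
    (forall (n m p : even_nat) (D2 : frieze_hom m p) (D1 : frieze_hom n m),
       frieze_of (compose DB D2 D1) = frieze_comp D2 D1) /\
    exists S : functor DB Delta,
      (forall n : nat, S (twice n) = n) /\
      (forall (n m : even_nat) (D : frieze_hom n m) (i : 'I_(S n)),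
         nat_of_ord (on_hom S D i) = phi D i) /\
      is_isomorphism S.
Proof.
exists frieze_category; split; [by []|split; [by []|]].
exists restriction; split; [exact: half_twice|split; [by []|]].
exists realization; split.
- apply: (@functor_ext _ _ _ _ _ _ _ frieze_of).
  + exact: frieze_hom_inj.
  + by move=> x; apply: even_nat_inj; apply: even_half.
  + by move=> x y D; apply: phi_inj; rewrite phi_realize extend_restrict.
- apply: (@functor_ext _ _ _ _ _ _ _ extend).
  + exact: extend_inj.
  + exact: half_twice.
  + move=> n m f.
    exact: etrans (extend_restrict (realize f)) (phi_realize f).
Qed.
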